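(* For $t\in(0,1)$ and $n\ge1$, with $H_n(t):=t(t-1)\frac{d}{dt}\ln D_n(t)$, $$H_n(t)=(2n+\alpha+\beta)(y_n-tr_n)-n(n+\alpha)=-(2n+\alpha+\beta)\mathsf p_1(n,t)-n(n+\alpha),$$ and $$r_n(t)=-\frac{H_n'(t)}{2n+\alpha+\beta},\qquad y_n(t)=\frac{-tH_n'(t)+H_n(t)+n(n+\alpha)}{2n+\alpha+\beta}.$$
   Context: Fix $\alpha>0$, $\beta>0$, and real $A,B$ with $A\ge0$, $A+B\ge0$, not both zero; $\theta$ is the Heaviside step function. For $t\in(0,1)$ let $w(x;t)=x^\alpha(1-x)^\beta(A+B\theta(x-t))$ on $[0,1]$, with moments $\mu_i(t)=\int_0^1x^iw\,dx$ and Hankel determinant $D_n(t)=\det(\mu_{j+k}(t))_{j,k=0}^{n-1}$. Let $P_n(x)=P_n(x;t)=x^n+\mathsf p_1(n,t)x^{n-1}+\cdots$ be the monic orthogonal polynomials: $\int_0^1P_iP_jw\,dx=h_i(t)\delta_{ij}$, $h_i>0$. Define $r_n(t)=B\,t^\alpha(1-t)^\beta P_n(t;t)P_{n-1}(t;t)/h_{n-1}$ and $y_n(t)=\frac{\beta}{h_{n-1}}\int_0^1\frac{P_n(y)P_{n-1}(y)}{1-y}\,y^\alpha(1-y)^\beta(A+B\theta(y-t))\,dy$. A prime denotes $d/dt$. *)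

(* Defs.v *)
From Stdlib Require Import Reals Lra ClassicalEpsilon.
Open Scope R_scope.

(* Heaviside step function (value at 0 is irrelevant). *)
Definition theta (x : R) : R := if Rlt_dec x 0 then 0 else 1.

Fixpoint sumR (m : nat) (f : nat -> R) : R :=
  match m with O => 0 | S m' => sumR m' f + f m' end.

(* Integral over (0,1), as an (improper) Riemann integral:
   limit of RiemannInt over [a,b] as a -> 0+, b -> 1-.
   Coincides with the ordinary integral for Riemann-integrable integrands. *)
Definition imp_int01 (f : R -> R) (l : R) : Prop :=
  (forall a b, 0 < a -> a <= b -> b < 1 -> inhabited (Riemann_integrable f a b)) /\
  (forall eps, 0 < eps -> exists del, 0 < del /\
     forall a b (pr : Riemann_integrable f a b),
       0 < a -> a < del -> 1 - del < b -> b < 1 ->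
       Rabs (RiemannInt pr - l) < eps).

Definition Integral01 (f : R -> R) : R := epsilon (inhabits 0) (imp_int01 f).

Definition w (al be A B t x : R) : R :=
  Rpower x al * Rpower (1 - x) be * (A + B * theta (x - t)).

Definition mu (al be A B t : R) (i : nat) : R :=
  Integral01 (fun x => x ^ i * w al be A B t x).

Fixpoint detn (n : nat) (M : nat -> nat -> R) : R :=
  match n with
  | O => 1
  | S m => sum_f_R0 (fun j => (-1) ^ j * M O j *
             detn m (fun i k => M (S i) (if Nat.ltb k j then k else S k))) m
  end.

Definition Dn (al be A B : R) (n : nat) (t : R) : R :=
  detn n (fun j k => mu al be A B t (j + k)).

Definition polyval (n : nat) (c : nat -> R) (x : R) : R :=
  x ^ n + sumR n (fun k => c k * x ^ k).

Definition is_OPS (al be A B t : R) (cf : nat -> nat -> R) : Prop :=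
  (forall i j, i <> j ->
     Integral01 (fun x => polyval i (cf i) x * polyval j (cf j) x * w al be A B t x) = 0) /\
  (forall i, 0 < Integral01 (fun x => polyval i (cf i) x * polyval i (cf i) x * w al be A B t x)).

Definition OPc (al be A B t : R) : nat -> nat -> R :=
  epsilon (inhabits (fun _ _ => 0)) (is_OPS al be A B t).

Definition P (al be A B : R) (n : nat) (t x : R) : R := polyval n (OPc al be A B t n) x.

Definition h (al be A B : R) (i : nat) (t : R) : R :=
  Integral01 (fun x => P al be A B i t x * P al be A B i t x * w al be A B t x).

(* p_1(n,t): coefficient of x^(n-1) in P_n (for n >= 1) *)
Definition p1 (al be A B : R) (n : nat) (t : R) : R := OPc al be A B t n (Nat.pred n).

Definition r (al be A B : R) (n : nat) (t : R) : R :=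
  B * Rpower t al * Rpower (1 - t) be * P al be A B n t t * P al be A B (n - 1) t t
    / h al be A B (n - 1) t.

Definition y (al be A B : R) (n : nat) (t : R) : R :=
  be / h al be A B (n - 1) t *
  Integral01 (fun u => P al be A B n t u * P al be A B (n - 1) t u / (1 - u)
                        * w al be A B t u).

Definition Hn (al be A B : R) (n : nat) (t : R) : R :=
  t * (t - 1) * epsilon (inhabits 0)
    (fun l => derivable_pt_lim (fun s => ln (Dn al be A B n s)) t l).

(* Main.v *)
From HB Require Import structures.
Require Import Defs.
From Stdlib Require Import Reals Lra ClassicalEpsilon.
From mathcomp Require Import ssreflect.
From mathcomp Require all_boot all_order all_algebra ring Rstruct.
From Coquelicot Require Import Coquelicot.
Open Scope R_scope.

(** Write [W x = x^al (1-x)^be] and let [L_t p] be the integral of [p w(.;t)].  As the weight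
    jumps only at [t], [d/dt L_t p = - B W(t) p(t)] for a fixed polynomial [p].  Cramer's rule
    shows that the coefficients of [P_n] are differentiable in [t], and
    [D_n = h_0 ... h_(n-1)].  Differentiating [h_k = L_t (P_k^2)] and
    [0 = L_t (P_n P_(n-1))], where [dP_n/dt] has degree [< n], gives
    [h_k' = - B W(t) P_k(t)^2] and [p_1(n)' = r_n]; hence
    [H_n = t (1-t) B W(t) sum_(k<n) P_k(t)^2 / h_k].
    Integrating the derivative of [x (1-x) W P_k^2] expresses the [k]-th summand through
    [p_1(k)] and [p_1(k+1)], and the sum telescopes to
    [- (2n+al+be) p_1(n) - n (n+al)].  Integrating the derivative of [x W P_n P_(n-1)],
    without the factor [1-x], produces the integral in [y_n] and gives
    [y_n - t r_n = - p_1(n)]. *)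

(** * Improper integrals *)

Lemma at_right_interval (a b : R) : a < b -> at_right a (fun x => a < x < b).
Proof. by move=> ab; apply: (locally_interval _ a m_infty b). Qed.

Lemma at_left_interval (a b : R) : a < b -> at_left b (fun x => a < x < b).
Proof. by move=> ab; apply: (locally_interval _ b a p_infty). Qed.

Lemma is_RInt_gen_lincomb {Fa Fb : (R -> Prop) -> Prop} {FFa : Filter Fa} {FFb : Filter Fb}
    (c d : R) (f g : R -> R) (l k : R) :
  is_RInt_gen f Fa Fb l -> is_RInt_gen g Fa Fb k ->
  is_RInt_gen (fun x => c * f x + d * g x) Fa Fb (c * l + d * k).
Proof. by move=> intf intg; apply: is_RInt_gen_plus; apply: is_RInt_gen_scal. Qed.

Lemma is_RInt_gen_ext_itv {a b : R} {f g : R -> R} {l : R} : a < b ->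
  is_RInt_gen f (at_right a) (at_left b) l -> (forall x, a < x < b -> f x = g x) ->
  is_RInt_gen g (at_right a) (at_left b) l.
Proof.
move=> ab intf fg; apply: is_RInt_gen_ext intf.
apply: (Filter_prod _ _ _ _ _ (at_right_interval _ _ ab) (at_left_interval _ _ ab)).
move=> u v u_in v_in x /= x_in; apply: fg; move: x_in.
by rewrite /Rmin /Rmax; case: Rle_dec; lra.
Qed.

Section OpenInterval.
Variables a b : R.

Lemma is_RInt_gen_uniq (f : R -> R) (l l' : R) :
  is_RInt_gen f (at_right a) (at_left b) l -> is_RInt_gen f (at_right a) (at_left b) l' -> l = l'.
Proof. by move=> /is_RInt_gen_unique <- /is_RInt_gen_unique <-. Qed.

Lemma is_RInt_gen_ex_RInt (f : R -> R) (l u v : R) :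
  is_RInt_gen f (at_right a) (at_left b) l -> a < u -> u <= v -> v < b -> ex_RInt f u v.
Proof.
move=> intf au uv vb; have [Q S nearQ nearS QS] := intf _ filter_true.
have [c [Qc /= c_in]] := filter_ex _ (filter_and _ _ nearQ (at_right_interval _ _ au)).
have [d [Sd /= d_in]] := filter_ex _ (filter_and _ _ nearS (at_left_interval _ _ vb)).
have [y [intcd _]] := QS c d Qc Sd.
apply: (ex_RInt_Chasles_1 _ u v d); first by lra.
by apply: (ex_RInt_Chasles_2 _ c u d); [lra | exists y].
Qed.

Variables K phi : R -> R.
Hypotheses (DK : forall x, a < x < b -> is_derive K x (phi x))
           (cphi : forall x, a < x < b -> continuous phi x).

Lemma is_RInt_gen_primitive {Fa Fb : (R -> Prop) -> Prop} {FFa : Filter Fa} {FFb : Filter Fb}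
    (la lb : R) : Fa (fun x => a < x < b) -> Fb (fun x => a < x < b) ->
  filterlim K Fa (locally la) -> filterlim K Fb (locally lb) -> is_RInt_gen phi Fa Fb (lb - la).
Proof.
move=> nearFa nearFb limKa limKb.
have between (Q : R -> Prop) : (forall x, a < x < b -> Q x) -> filter_prod Fa Fb
    (fun uv => forall x, Rmin (fst uv) (snd uv) <= x <= Rmax (fst uv) (snd uv) -> Q x).
  move=> Q_itv; apply: (Filter_prod _ _ _ _ _ nearFa nearFb) => u v u_in v_in x /= x_in.
  by apply: Q_itv; move: x_in; rewrite /Rmin /Rmax; case: Rle_dec; lra.
have DerK x : a < x < b -> Derive K x = phi x by move=> ?; apply/is_derive_unique/DK.
apply: (is_RInt_gen_ext (Derive K)).
  by apply: filter_imp (between _ DerK) => uv eqK x x_in; apply: eqK; lra.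
apply: is_RInt_gen_Derive limKa limKb; apply: between => x x_in.
  by exists (phi x); apply: DK.
apply: (continuous_ext_loc _ phi); last exact: cphi.
by apply: (locally_interval _ x a b); try apply x_in; move=> z za zb; rewrite DerK.
Qed.

Lemma is_RInt_gen_step (A B t : R) : a < t < b -> continuous K a -> continuous K b ->
  is_RInt_gen (fun x => phi x * (A + B * theta (x - t))) (at_right a) (at_left b)
    (A * (K b - K a) + B * (K b - K t)).
Proof.
move=> t_in Ka Kb.
have nearA : at_right a (fun x => a < x < t) by apply: at_right_interval; lra.
have nearB : at_left b (fun x => t < x < b) by apply: at_left_interval; lra.
have limKt : filterlim K (at_point t) (locally (K t)) by move=> P /locally_singleton.
have -> : A * (K b - K a) + B * (K b - K t)
    = plus (scal A (K t - K a)) (scal (A + B) (K b - K t)).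
  by rewrite /plus /scal /= /mult /=; ring.
apply: (is_RInt_gen_Chasles _ t).
- apply: (is_RInt_gen_ext (fun x => scal A (phi x))).
    apply: (Filter_prod _ _ _ _ (fun x => x = t) nearA) => //= u _ u_in -> x.
    rewrite Rmin_left ?Rmax_right; try lra.
    by rewrite /theta /scal /= /mult /= => x_in; case: Rlt_dec => ?; [ring | lra].
  apply: is_RInt_gen_scal; apply: is_RInt_gen_primitive => //.
    by apply: filter_imp nearA => x; lra.
  by apply: (filterlim_filter_le_1 (F := locally a)) => //; apply: filter_le_within.
- apply: (is_RInt_gen_ext (fun x => scal (A + B) (phi x))).
    apply: (Filter_prod _ _ _ (fun x => x = t) _ _ nearB) => //= _ v -> v_in x.
    rewrite Rmin_left ?Rmax_right; try lra.
    by rewrite /theta /scal /= /mult /= => x_in; case: Rlt_dec => ?; [lra | ring].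
  apply: is_RInt_gen_scal; apply: is_RInt_gen_primitive => //.
    by apply: filter_imp nearB => x; lra.
  by apply: (filterlim_filter_le_1 (F := locally b)) => //; apply: filter_le_within.
Qed.

End OpenInterval.

Lemma imp_int01_is_RInt_gen (f : R -> R) (l : R) :
  imp_int01 f l <-> is_RInt_gen f (at_right 0) (at_left 1) l.
Proof.
split=> [[intf liml] P [eps ballP] | intf].
- have [d [d0 close]] := liml eps (cond_pos eps).
  have d'_gt0 : 0 < Rmin d (1 / 2) by apply: Rmin_pos; lra.
  have [le_d'd le_d'half] := conj (Rmin_l d (1 / 2)) (Rmin_r d (1 / 2)).
  move: (Rmin d (1 / 2)) => d' in d'_gt0 le_d'd le_d'half *.
  apply: (Filter_prod _ _ _ (fun a => 0 < a < d') (fun b => 1 - d' < b < 1)).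
  + by apply: at_right_interval.
  + by apply: at_left_interval; lra.
  + move=> a b a_in b_in; have [|||pr] := intf a b; try lra.
    exists (RInt f a b); split; first by apply: RInt_correct; apply: ex_RInt_Reals_1.
    by apply: ballP; rewrite (RInt_Reals _ _ _ pr); apply: close; lra.
- split=> [a b a0 ab b1 | e e0].
    by constructor; apply: ex_RInt_Reals_0; apply: (is_RInt_gen_ex_RInt 0 1 f l).
  have [Q S [dQ nearQ] [dS nearS] QS] := intf _ (locally_ball l (mkposreal e e0)).
  exists (Rmin dQ dS); split; first exact: Rmin_stable_in_posreal.
  move=> a b pr a0 ad bd b1.
  have [le_dQ le_dS] := conj (Rmin_l dQ dS) (Rmin_r dQ dS).
  have [||v [intv closev]] := QS a b.
  + by apply: nearQ => //; change (Rabs (a - 0) < dQ); rewrite Rabs_pos_eq; lra.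
  + by apply: nearS => //; change (Rabs (b - 1) < dS); rewrite Rabs_left; lra.
  + by rewrite -RInt_Reals (is_RInt_unique _ _ _ _ intv).
Qed.

Lemma Integral01_is_RInt_gen (f : R -> R) (l : R) :
  is_RInt_gen f (at_right 0) (at_left 1) l -> Integral01 f = l.
Proof.
move=> intf; suff /imp_int01_is_RInt_gen intf' : imp_int01 f (Integral01 f).
  exact: is_RInt_gen_uniq intf' intf.
by apply: epsilon_spec; exists l; apply/imp_int01_is_RInt_gen.
Qed.

Section ContinuousIntegrand.
Variable f : R -> R.
Hypothesis cf : forall x, continuous f x.

Let intf a b : ex_RInt f a b.
Proof. by apply: ex_RInt_continuous. Qed.

Lemma is_derive_RInt_upper (a x : R) : is_derive (RInt f a) x (f x).
Proof.
by apply: (is_derive_RInt _ _ a) => //; apply: filter_forall => z; apply: RInt_correct.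
Qed.

Lemma is_derive_RInt_lower (b x : R) : is_derive (fun z => RInt f z b) x (- f x).
Proof.
by apply: (is_derive_RInt' _ _ _ b) => //; apply: filter_forall => z; apply: RInt_correct.
Qed.

Lemma RInt_gt0_of_point (a b x : R) : (forall z, a <= z <= b -> 0 <= f z) ->
  a < x < b -> 0 < f x -> 0 < RInt f a b.
Proof.
move=> f_ge0 x_in fx_gt0.
have RInt_ge0 u v : a <= u -> u <= v -> v <= b -> 0 <= RInt f u v.
  by move=> au uv vb; apply: RInt_ge_0 => // z z_in; apply: f_ge0; lra.
case: (RInt_ge0 a b) => //; try lra; move=> RInt0.
suff : f x = 0 by lra.
rewrite -(is_derive_unique _ _ _ (is_derive_RInt_upper a x)).
rewrite (Derive_ext_loc _ (fun _ => 0)) ?Derive_const //.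
apply: (locally_interval _ x a b); try apply x_in; move=> z /= az zb.
have := RInt_Chasles f a z b (intf _ _) (intf _ _); rewrite /plus /=.
have := RInt_ge0 a z; have := RInt_ge0 z b; lra.
Qed.

Variables A B : R.

Definition step_RInt (t : R) : R := A * RInt f 0 1 + B * RInt f t 1.

Lemma is_RInt_gen_step_RInt (t : R) : 0 < t < 1 ->
  is_RInt_gen (fun x => f x * (A + B * theta (x - t))) (at_right 0) (at_left 1) (step_RInt t).
Proof.
move=> t_in; pose K := RInt f 0; have DK x : is_derive K x (f x) by apply: is_derive_RInt_upper.
have -> : step_RInt t = A * (K 1 - K 0) + B * (K 1 - K t).
  by rewrite /step_RInt /K RInt_point -(RInt_Chasles f 0 t 1) // /plus /zero /=; ring.
by apply: is_RInt_gen_step => //; apply: ex_derive_continuous; eexists; apply: DK.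
Qed.

Lemma is_derive_step_RInt (t : R) : is_derive step_RInt t (- B * f t).
Proof.
have -> : - B * f t = plus zero (B * - f t) by rewrite /plus /zero /=; ring.
apply: is_derive_plus; first exact: is_derive_const.
exact/is_derive_scal/is_derive_RInt_lower.
Qed.

Lemma step_RInt_gt0 (t : R) : 0 <= A -> 0 <= A + B -> ~ (A = 0 /\ B = 0) ->
  (forall z, 0 <= z <= 1 -> 0 <= f z) -> 0 <= t <= 1 ->
  (exists x, 0 < x < t /\ 0 < f x) -> (exists x, t < x < 1 /\ 0 < f x) ->
  0 < step_RInt t.
Proof.
move=> A_ge0 AB_ge0 AB_neq0 f_ge0 t_in [x [x_in fx]] [z [z_in fz]].
have left_gt0 : 0 < RInt f 0 t by apply: RInt_gt0_of_point x_in fx => u ?; apply: f_ge0; lra.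
have right_gt0 : 0 < RInt f t 1 by apply: RInt_gt0_of_point z_in fz => u ?; apply: f_ge0; lra.
have -> : step_RInt t = A * RInt f 0 t + (A + B) * RInt f t 1.
  by rewrite /step_RInt -(RInt_Chasles f 0 t 1) // /plus /=; ring.
have [A0 | A_neq0] := Req_dec A 0; nra.
Qed.

End ContinuousIntegrand.

(** * The Jacobi weight *)

(* Stdlib's [Rpower 0 a] is [1]; this is the continuous extension of [x ^ a] by [0]. *)
Definition pos_power (a x : R) : R := if Rlt_dec 0 x is left _ then Rpower x a else 0.

Lemma pos_powerE (a x : R) : 0 < x -> pos_power a x = Rpower x a.
Proof. by rewrite /pos_power; case: Rlt_dec. Qed.

Lemma pos_power_le0 (a x : R) : x <= 0 -> pos_power a x = 0.
Proof. by rewrite /pos_power; case: Rlt_dec => //; lra. Qed.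

Lemma pos_power_ge0 (a x : R) : 0 <= pos_power a x.
Proof. by rewrite /pos_power; case: Rlt_dec => *; [left; apply: exp_pos | right]. Qed.

Lemma continuous_pos_power (a x : R) : 0 < a -> continuous (pos_power a) x.
Proof.
move=> a_gt0; have [x_lt0 | [-> | x_gt0]] := Rtotal_order x 0.
- apply: (continuous_ext_loc _ (fun _ => 0)); last exact: continuous_const.
  by apply: (locally_interval _ x m_infty 0) => // z _ /= ?; rewrite pos_power_le0; lra.
- move=> Q [e ballQ]; have d_gt0 : 0 < Rpower e (/ a) by apply: exp_pos.
  exists (mkposreal _ d_gt0) => z near_z; apply: ballQ.
  change (Rabs (pos_power a z - pos_power a 0) < e).
  have z_small : Rabs (z - 0) < Rpower e (/ a) by exact: near_z.
  rewrite (pos_power_le0 a 0) ?Rminus_0_r; last exact: Rle_refl.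
  rewrite Rabs_pos_eq; last exact: pos_power_ge0.
  have [z_le0 | z_gt0] := Rle_lt_dec z 0; first by rewrite pos_power_le0 //; apply: cond_pos.
  have -> : pos e = Rpower (Rpower e (/ a)) a.
    by rewrite Rpower_mult Rinv_l ?Rpower_1 //; [apply: cond_pos | lra].
  rewrite pos_powerE //; apply: Rlt_Rpower_l => //.
  by move: z_small; rewrite Rminus_0_r Rabs_pos_eq; lra.
- apply: (continuous_ext_loc _ (fun z => Rpower z a)).
    by apply: (locally_interval _ x 0 p_infty) => // z z_gt0 _; rewrite pos_powerE.
  by apply: ex_derive_continuous; rewrite /Rpower; auto_derive.
Qed.

Definition jacobi (al be x : R) : R := pos_power al x * pos_power be (1 - x).

Section JacobiWeight.
Variables al be : R.

Lemma jacobiE (x : R) : 0 < x < 1 -> jacobi al be x = Rpower x al * Rpower (1 - x) be.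
Proof. by move=> x_in; rewrite /jacobi !pos_powerE; lra. Qed.

Lemma jacobi_at1 : jacobi al be 1 = 0.
Proof. by rewrite /jacobi (pos_power_le0 be); lra. Qed.

Lemma jacobi_ge0 (x : R) : 0 <= jacobi al be x.
Proof. by apply: Rmult_le_pos; apply: pos_power_ge0. Qed.

Lemma jacobi_gt0 (x : R) : 0 < x < 1 -> 0 < jacobi al be x.
Proof. by move=> /jacobiE ->; apply: Rmult_lt_0_compat; apply: exp_pos. Qed.

Lemma continuous_jacobi (x : R) : 0 < al -> 0 < be -> continuous (jacobi al be) x.
Proof.
move=> al_gt0 be_gt0; apply: continuous_mult; first exact: continuous_pos_power.
apply: (continuous_comp (fun x => 1 - x)); last exact: continuous_pos_power.
by apply: ex_derive_continuous; auto_derive.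
Qed.

Lemma is_derive_jacobi (x : R) : 0 < x < 1 ->
  is_derive (jacobi al be) x ((al / x - be / (1 - x)) * jacobi al be x).
Proof.
move=> x_in; rewrite jacobiE //.
apply: (is_derive_ext_loc (fun z => Rpower z al * Rpower (1 - z) be)).
  by apply: (locally_interval _ x 0 1); try apply x_in; move=> z z0 z1; rewrite jacobiE.
by rewrite /Rpower; auto_derive; [lra | rewrite /Rminus; field; lra].
Qed.

Lemma continuous_logderiv_jacobi (x : R) : 0 < x < 1 ->
  continuous (fun x => al / x - be / (1 - x)) x.
Proof. by move=> x_in; apply: ex_derive_continuous; auto_derive; lra. Qed.

End JacobiWeight.

Definition in01 (x : R) : Prop := 0 < x < 1.

Lemma locally_in01 (x : R) : in01 x -> locally x in01.
Proof. by move=> [x0 x1]; apply: (locally_interval _ x 0 1). Qed.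

(** * Orthogonal polynomials of a moment sequence *)

Module MomentFunctionals.
Import all_boot all_algebra ring.
Import GRing.Theory.
Local Open Scope ring_scope.
Set Implicit Arguments.
Unset Strict Implicit.

Section MonicOfDegree.
Variable R : comNzRingType.
Implicit Types p q : {poly R}.

Definition monic_deg n p : Prop := (size p <= n.+1)%N /\ p`_n = 1.

Lemma monic_deg_neq0 n p : monic_deg n p -> p != 0.
Proof. by case=> _; apply: contra_eq_neq => ->; rewrite coef0 eq_sym oner_eq0. Qed.

Lemma monic_deg_addXn n p : (size p <= n)%N -> monic_deg n ('X^n + p).
Proof.
move=> le_pn; split; last by rewrite coefD coefXn eqxx nth_default ?addr0.
by rewrite (leq_trans (size_polyD _ _)) // geq_max size_polyXn leqnn ltnW.
Qed.

Lemma size_sub_lead n p q : (size p <= n.+1)%N -> monic_deg n q ->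
  (size (p - p`_n *: q)%R <= n)%N.
Proof.
move=> le_pn [le_qn q_n]; apply/leq_sizeP => j; rewrite leq_eqVlt coefB coefZ.
case/predU1P=> [<-|lt_nj]; first by rewrite q_n mulr1 subrr.
by rewrite [p`_j]nth_default ?[q`_j]nth_default ?mulr0 ?subrr // (leq_trans _ lt_nj).
Qed.

Definition monic_of_coefs n (c : nat -> R) : {poly R} := 'X^n + \poly_(k < n) c k.

Lemma monic_of_coefs_deg n c : monic_deg n (monic_of_coefs n c).
Proof. by apply: monic_deg_addXn; rewrite size_poly. Qed.

Lemma coef_monic_of_coefs n c k : (k < n)%N -> (monic_of_coefs n c)`_k = c k.
Proof. by move=> lt_kn; rewrite coefD coefXn coef_poly lt_kn ltn_eqF // add0r. Qed.

Lemma monic_of_coefsK n p : monic_deg n p -> monic_of_coefs n (fun k => p`_k) = p.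
Proof.
case=> le_pn p_n; have [le_cn c_n] := monic_of_coefs_deg n (fun k => p`_k).
apply/polyP => k; case: (ltngtP k n) => [lt_kn | lt_nk | ->]; last by rewrite p_n.
  exact: coef_monic_of_coefs.
by rewrite !nth_default // (leq_trans _ lt_nk).
Qed.

End MonicOfDegree.

Section RieszFunctional.
Variables (R : comNzRingType) (m : nat -> R).

Definition riesz (p : {poly R}) : R := \sum_(i < size p) p`_i * m i.

Lemma riesz_coef_wide n (p : {poly R}) :
  (size p <= n)%N -> riesz p = \sum_(i < n) p`_i * m i.
Proof.
move=> le_pn; rewrite /riesz (big_ord_widen n (fun i => p`_i * m i)) // big_mkcond.
by apply: eq_bigr => i _; case: ltnP => // /(nth_default 0) ->; rewrite mul0r.
Qed.

Fact riesz_is_scalar : scalar riesz.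
Proof.
move=> a p q; set n := maxn (size p) (size q).
have le_pn : (size p <= n)%N by rewrite leq_maxl.
have le_qn : (size q <= n)%N by rewrite leq_maxr.
have le_apqn : (size (a *: p + q)%R <= n)%N.
  rewrite (leq_trans (size_polyD _ _)) // geq_max le_qn.
  by rewrite (leq_trans (size_scale_leq _ _)).
rewrite !(riesz_coef_wide (n := n)) // mulr_sumr -big_split.
by apply: eq_bigr => i _; rewrite coefD coefZ mulrDl mulrA.
Qed.

HB.instance Definition _ := GRing.isLinear.Build R {poly R} R *%R riesz riesz_is_scalar.

Lemma riesz_Xn n : riesz 'X^n = m n.
Proof.
rewrite /riesz size_polyXn big_ord_recr big1 /= => [|i _].
  by rewrite coefXn eqxx mul1r add0r.
by rewrite coefXn (ltn_eqF (ltn_ord i)) mul0r.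
Qed.

Definition hankel n : 'M[R]_n := \matrix_(i, j) m (i + j).

Lemma riesz_rVpolyM n (u v : 'rV[R]_n) :
  riesz (rVpoly u * rVpoly v) = (u *m hankel n *m v^T) 0 0.
Proof.
have rVpolyE (w : 'rV_n) : rVpoly w = \sum_(i < n) w 0 i *: 'X^i.
  by rewrite /rVpoly poly_def; apply: eq_bigr => i _; rewrite valK.
rewrite !rVpolyE mulr_sumr linear_sum mxE; apply: eq_bigr => j _.
rewrite mulr_suml linear_sum !mxE mulr_suml; apply: eq_bigr => i _.
by rewrite -scalerAl -scalerAr -exprD !linearZ /= riesz_Xn !mxE; ring.
Qed.

Lemma det_hankel_orthogonal n (p : nat -> {poly R}) : (forall i, monic_deg i (p i)) ->
    (forall i j, i != j -> riesz (p i * p j) = 0) ->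
  \det (hankel n) = \prod_(i < n) riesz (p i * p i).
Proof.
move=> p_deg p_orth; pose C : 'M[R]_n := \matrix_i poly_rV (p i).
have size_p i : (size (p i) <= i.+1)%N by case: (p_deg i).
have C_trig : is_trig_mx C.
  by apply/is_trig_mxP => i j lt_ij; rewrite !mxE nth_default // (leq_trans (size_p i)).
have det_C : \det C = 1.
  by rewrite det_trig // big1 // => i _; rewrite !mxE; case: (p_deg i).
have gramE : C *m hankel n *m C^T = diag_mx (\row_i riesz (p i * p i)).
  apply/matrixP => i j; have rowC k : rVpoly (row k C) = p k.
    by rewrite rowK poly_rV_K // (leq_trans (size_p k)).
  have -> : (C *m hankel n *m C^T) i j = (row i C *m hankel n *m (row j C)^T) 0 0.
    by rewrite -row_mul !mxE; apply: eq_bigr => k _; rewrite !mxE.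
  rewrite -riesz_rVpolyM !rowC !mxE.
  by case: eqP => [->|/eqP ne_ij]; rewrite ?mulr1n // mulr0n p_orth.
have := congr1 determinant gramE; rewrite !det_mulmx det_tr det_C mul1r mulr1 det_diag => ->.
by apply: eq_bigr => i _; rewrite mxE.
Qed.

End RieszFunctional.

Lemma riesz_dirac (R : comNzRingType) (c t : R) (p : {poly R}) :
  riesz (fun k => c * t ^+ k) p = c * p.[t].
Proof. by rewrite horner_coef mulr_sumr; apply: eq_bigr => i _; rewrite mulrCA. Qed.

Section OrthogonalPolynomials.
Variables (F : fieldType) (m : nat -> F).
Implicit Types p q : {poly F}.

Local Notation L := (riesz m).

Definition anisotropic : Prop := forall p, L (p * p) = 0 -> p = 0.

(* [invmx] is the identity on singular matrices: this is the monic orthogonal polynomial only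
   when [hankel m n] is invertible. *)
Definition orthopoly n : {poly F} :=
  'X^n - rVpoly ((\row_(j < n) m (n + j)) *m invmx (hankel m n)).

Local Notation P := orthopoly.

Lemma orthopoly_deg n : monic_deg n (P n).
Proof. by apply: monic_deg_addXn; rewrite size_polyN size_poly. Qed.

Lemma size_orthopoly n : (size (P n) <= n.+1)%N.
Proof. by case: (orthopoly_deg n). Qed.

Lemma coef_orthopoly_lead n : (P n)`_n = 1.
Proof. by case: (orthopoly_deg n). Qed.

Lemma coef_orthopoly n (k : 'I_n) :
  (P n)`_k = - \sum_(j < n) m (n + j) * invmx (hankel m n) j k.
Proof.
rewrite coefB coefXn (ltn_eqF (ltn_ord k)) coef_rVpoly_ord mxE sub0r; congr (- _).
by apply: eq_bigr => j _; rewrite mxE.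
Qed.

Hypothesis anisoL : anisotropic.

Lemma hankel_unitmx n : hankel m n \in unitmx.
Proof.
rewrite -row_free_unit -kermx_eq0; apply/eqP/row_matrixP => i.
set u := row i _; have uH0 : u *m hankel m n = 0 by apply/sub_kermxP/row_sub.
have: rVpoly u = 0 by apply: anisoL; rewrite riesz_rVpolyM uH0 mul0mx mxE.
by move/(congr1 (poly_rV (d := n))); rewrite rVpolyK linear0 row0.
Qed.

Lemma riesz_orthopoly_low n q : (size q <= n)%N -> L (P n * q) = 0.
Proof.
move=> /poly_rV_K <-; set v := poly_rV q.
rewrite mulrBl linearB /= riesz_rVpolyM mulmxKV ?hankel_unitmx // mxE /rVpoly poly_def.
rewrite mulr_sumr linear_sum; apply/eqP; rewrite subr_eq0; apply/eqP/eq_bigr => j _.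
by rewrite -scalerAr -exprD linearZ /= riesz_Xn valK !mxE mulrC.
Qed.

Lemma orthopoly_unique n p : monic_deg n p ->
  (forall q, (size q <= n)%N -> L (p * q) = 0) -> p = P n.
Proof.
move=> [size_p p_n] p_orth; apply/eqP; rewrite -subr_eq0; apply/eqP/anisoL.
have := size_sub_lead size_p (orthopoly_deg n); rewrite p_n scale1r => le_n.
by rewrite mulrBl linearB /= p_orth // riesz_orthopoly_low // subrr.
Qed.

Lemma orthogonal_monicsE (p : nat -> {poly F}) : (forall i, monic_deg i (p i)) ->
  (forall i j, i != j -> L (p i * p j) = 0) -> p =1 P.
Proof.
move=> p_deg p_orth n; apply: orthopoly_unique => // q.
have low k : (k <= n)%N -> forall q, (size q <= k)%N -> L (p n * q) = 0.
  elim: k => [_|k IH lt_kn] {}q le_qk.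
    by move: le_qk; rewrite leqn0 size_poly_eq0 => /eqP ->; rewrite mulr0 linear0.
  rewrite -(subrK (q`_k *: p k) q) mulrDr linearD /= IH ?size_sub_lead ?(ltnW lt_kn) //.
  by rewrite add0r -scalerAr linearZ /= p_orth ?mulr0 // gtn_eqF.
exact: low.
Qed.

Lemma riesz_orthopoly_neq i j : i != j -> L (P i * P j) = 0.
Proof.
by rewrite neq_ltn => /orP[] lt_ij; [rewrite mulrC|];
  rewrite riesz_orthopoly_low // (leq_trans (size_orthopoly _)).
Qed.

Definition sqnorm n : F := L (P n * P n).

Lemma sqnorm_neq0 n : sqnorm n != 0.
Proof. by apply/eqP => /anisoL/eqP; apply/negP/monic_deg_neq0/orthopoly_deg. Qed.

Lemma riesz_orthopoly n p : (size p <= n.+1)%N -> L (P n * p) = p`_n * sqnorm n.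
Proof.
move=> le_pn; rewrite -[in LHS](subrK (p`_n *: P n) p) mulrDr linearD /=.
rewrite riesz_orthopoly_low; last exact: size_sub_lead (orthopoly_deg n).
by rewrite add0r -scalerAr linearZ.
Qed.

(* The convention at [n = 0] lets [riesz_jacobi_op_sqr] hold from [n = 0] on. *)
Definition subleading n : F := if n is k.+1 then (P n)`_k else 0.

Lemma riesz_orthopoly_succ n p : (size p <= n.+2)%N ->
  L (P n * p) = (p`_n - p`_n.+1 * subleading n.+1) * sqnorm n.
Proof.
move=> le_pn; rewrite -[in LHS](subrK (p`_n.+1 *: P n.+1) p) mulrDr linearD /=.
rewrite -scalerAr [L (_ *: _)]linearZ /= riesz_orthopoly_neq ?ltn_eqF // mulr0 addr0.
rewrite riesz_orthopoly; last exact: size_sub_lead (orthopoly_deg n.+1).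
by rewrite coefB coefZ.
Qed.

Lemma det_hankel n : \det (hankel m n) = \prod_(i < n) sqnorm i.
Proof. exact: det_hankel_orthogonal orthopoly_deg riesz_orthopoly_neq. Qed.

Lemma coef_X_deriv p k : ('X * p^`())`_k = k%:R * p`_k.
Proof. by rewrite coefXM; case: k => [|k]; rewrite ?mul0r // coef_deriv mulr_natl. Qed.

Lemma size_X_deriv n p : (size p <= n)%N -> (size ('X * p^`())%R <= n)%N.
Proof.
move=> le_pn; apply/leq_sizeP => k le_nk.
by rewrite coef_X_deriv nth_default ?mulr0 // (leq_trans le_pn).
Qed.

Section JacobiOperator.
Variables al be : F.

(* For [W = x^al (1-x)^be], this is [q |-> W^-1 (x (1-x) W q)']. *)
Definition jacobi_op q : {poly F} :=
  ((1 + al)%:P - (2 + al + be) *: 'X) * q + 'X * (1 - 'X) * q^`().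

Definition jacobi_half_op p : {poly F} :=
  (1 + al) *: p - (2 + al + be) *: ('X * p) + ('X * p^`()) *+ 2 - ('X * ('X * p^`())) *+ 2.

Lemma jacobi_op_sqr p : jacobi_op (p * p) = p * jacobi_half_op p.
Proof. by rewrite /jacobi_op /jacobi_half_op derivM -!mul_polyC; ring. Qed.

Lemma coef_jacobi_half_op p k :
  (jacobi_half_op p)`_k = (1 + al + 2 * k%:R) * p`_k
    - (if k is j.+1 then (2 * k%:R + al + be) * p`_j else 0).
Proof.
rewrite !(coefB, coefD, coefZ, coefMn, coef_X_deriv p, coefXM).
by case: k => [|k] /=; ring.
Qed.

(* The quantity [- H_n] of the theorem, in terms of [p_1(n)] only. *)
Definition jacobi_potential n : F := (2 * n%:R + al + be) * subleading n + n%:R * (n%:R + al).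

Lemma riesz_jacobi_op_sqr n :
  L (jacobi_op (P n * P n)) = (jacobi_potential n.+1 - jacobi_potential n) * sqnorm n.
Proof.
have P_gt k : (n < k)%N -> (P n)`_k = 0.
  by move=> lt_nk; rewrite nth_default // (leq_trans (size_orthopoly n)).
rewrite jacobi_op_sqr riesz_orthopoly_succ; last first.
  apply/leq_sizeP => -[//|k] lt_nk; rewrite coef_jacobi_half_op !P_gt //; first by ring.
  exact: ltnW.
congr (_ * _); rewrite !coef_jacobi_half_op !coef_orthopoly_lead P_gt // /jacobi_potential.
by case: n {P_gt} => [|n] /=; ring.
Qed.

Lemma riesz_X_deriv_succ n :
  L ((1 + al + be) *: (P n.+1 * P n) + 'X * (P n.+1 * P n)^`()) = - subleading n.+1 * sqnorm n.
Proof.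
have -> : (1 + al + be) *: (P n.+1 * P n) + 'X * (P n.+1 * P n)^`() =
  P n.+1 * ((1 + al + be) *: P n + 'X * (P n)^`()) + P n * ('X * (P n.+1)^`()).
  by rewrite derivM -!mul_polyC; ring.
rewrite linearD /= riesz_orthopoly_low; last first.
  rewrite (leq_trans (size_polyD _ _)) // geq_max size_X_deriv ?size_orthopoly // andbT.
  by rewrite (leq_trans (size_scale_leq _ _)) ?size_orthopoly.
rewrite riesz_orthopoly_succ ?size_X_deriv ?size_orthopoly //.
by rewrite !coef_X_deriv coef_orthopoly_lead /=; ring.
Qed.

End JacobiOperator.
End OrthogonalPolynomials.
End MomentFunctionals.

(** * Moments depending on a parameter *)

Module ParametricMoments.
Import all_boot all_algebra ring Rstruct.
Import GRing.Theory.
Import MomentFunctionals.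
Local Open Scope ring_scope.

Lemma is_derive_mulr (f g : R -> R) (x df dg : R) :
  is_derive f x df -> is_derive g x dg ->
  is_derive (fun z => f z * g z) x (df * g x + f x * dg).
Proof. by move=> Df Dg; apply: is_derive_mult => // ? ?; apply: Rmult_comm. Qed.

Section BigOperators.
Variables (x : R) (I : Type) (r : seq I) (F : I -> R -> R).

Lemma is_derive_sum (d : I -> R) : (forall i, is_derive (F i) x (d i)) ->
  is_derive (fun z => \sum_(i <- r) F i z) x (\sum_(i <- r) d i).
Proof.
move=> DF; elim: r => [|i s IH].
  apply: (is_derive_ext (fun=> 0 : R)) => [z|]; first by rewrite big_nil.
  by rewrite big_nil; apply: is_derive_const.
rewrite big_cons; apply: (is_derive_ext (fun z => F i z + \sum_(j <- s) F j z)) => [z|].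
  by rewrite big_cons.
exact: is_derive_plus.
Qed.

Lemma ex_derive_sum : (forall i, ex_derive (F i) x) ->
  ex_derive (fun z => \sum_(i <- r) F i z) x.
Proof. by move=> DF; eexists; apply: is_derive_sum => i; apply: Derive_correct. Qed.

Lemma ex_derive_prod : (forall i, ex_derive (F i) x) ->
  ex_derive (fun z => \prod_(i <- r) F i z) x.
Proof.
move=> DF; elim: r => [|i s IH].
  apply: (ex_derive_ext (fun=> 1 : R)) => [z|]; first by rewrite big_nil.
  exact: ex_derive_const.
apply: (ex_derive_ext (fun z => F i z * \prod_(j <- s) F j z)) => [z|].
  by rewrite big_cons.
exact: ex_derive_mult.
Qed.

Lemma is_derive_ln_prod (d : I -> R) :
  (forall i, is_derive (F i) x (d i)) -> (forall i, Rlt 0 (F i x)) ->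
  is_derive (fun z => ln (\prod_(i <- r) F i z)) x (\sum_(i <- r) d i / F i x).
Proof.
move=> DF F_gt0.
have prod_gt0 s : Rlt 0 (\prod_(i <- s) F i x).
  by elim/big_rec: _ => [|i z _ z_gt0]; [exact: Rlt_0_1 | exact: Rmult_lt_0_compat].
suff Dprod : is_derive (fun z => \prod_(i <- r) F i z) x
    ((\prod_(i <- r) F i x) * \sum_(i <- r) d i / F i x).
  have := is_derive_comp ln _ _ _ _ (is_derive_ln _ (prod_gt0 r)) Dprod.
  by rewrite /scal /= /mult /= !RealsE mulrAC mulfV ?mul1r //; apply/eqP/Rgt_not_eq.
elim: r => [|i s IH].
  apply: (is_derive_ext (fun=> 1 : R)) => [z|]; first by rewrite big_nil.
  by rewrite !big_nil mulr0; apply: is_derive_const.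
apply: (is_derive_ext (fun z => F i z * \prod_(j <- s) F j z)) => [z|].
  by rewrite big_cons.
have Fi_neq0 : F i x != 0 by apply/eqP/Rgt_not_eq.
by have := is_derive_mulr _ _ _ _ _ (DF i) IH; congr is_derive; rewrite !big_cons; field.
Qed.

End BigOperators.

Lemma is_RInt_gen_sum {Fa Fb : (R -> Prop) -> Prop} {FFa : Filter Fa} {FFb : Filter Fb}
    n (f : nat -> R -> R) (l : nat -> R) :
  (forall i, is_RInt_gen (f i) Fa Fb (l i)) ->
  is_RInt_gen (fun x => \sum_(i < n) f i x) Fa Fb (\sum_(i < n) l i).
Proof.
move=> intf; elim: n => [|n IH].
  apply: (is_RInt_gen_ext (fun x => 0 * f 0%N x)).
    by apply: filter_forall => ab x _; rewrite big_ord0 mul0r.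
  have -> : \sum_(i < 0) l i = 0 * l 0%N by rewrite big_ord0 mul0r.
  exact: is_RInt_gen_scal.
rewrite big_ord_recr; apply: (is_RInt_gen_ext (fun x => \sum_(i < n) f i x + f n x)).
  by apply: filter_forall => ab x _; rewrite big_ord_recr.
exact: is_RInt_gen_plus.
Qed.

Lemma ex_derive_det n (A : R -> 'M[R]_n) x :
  (forall i j, ex_derive (fun z => A z i j) x) -> ex_derive (fun z => \det (A z)) x.
Proof.
move=> DA; apply: ex_derive_sum => s.
by apply: ex_derive_mult; [apply: ex_derive_const | apply: ex_derive_prod].
Qed.

Lemma ex_derive_invmx n (A : R -> 'M[R]_n) x : locally x (fun z => A z \in unitmx) ->
    (forall i j, ex_derive (fun z => A z i j) x) ->
  forall i j, ex_derive (fun z => invmx (A z) i j) x.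
Proof.
move=> unitA DA i j.
apply: (ex_derive_ext_loc (fun z => (\det (A z))^-1 * cofactor (A z) j i)).
  by apply: filter_imp unitA => z unitA; rewrite /invmx unitA !mxE.
apply: ex_derive_mult.
  apply: ex_derive_inv; first exact: ex_derive_det.
  by apply/eqP; rewrite -unitfE -unitmxE (locally_singleton _ _ unitA).
apply: ex_derive_mult; first exact: ex_derive_const.
apply: ex_derive_det => k l.
by apply: ex_derive_ext (DA (lift j k) (lift i l)) => z; rewrite !mxE.
Qed.

Lemma is_derive_horner (p : {poly R}) (x : R) : is_derive (horner p) x p^`().[x].
Proof.
elim/poly_ind: p => [|p c IH].
  apply: (is_derive_ext (fun=> 0 : R)) => [z|]; first by rewrite horner0.
  by rewrite deriv0 horner0; apply: is_derive_const.
apply: (is_derive_ext (fun z => p.[z] * z + c)) => [z|]; first by rewrite hornerMXaddC.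
have DpX := is_derive_mulr _ _ _ _ _ IH (is_derive_id x).
have := is_derive_plus _ _ _ _ _ DpX (is_derive_const c x).
by rewrite derivMXaddC hornerD hornerMX /plus /zero /one /= !RealsE mulr1 addr0 addrC.
Qed.

Lemma continuous_horner (p : {poly R}) (x : R) : continuous (horner p) x.
Proof. by apply: ex_derive_continuous; eexists; apply: is_derive_horner. Qed.

Definition is_derive_poly (p : R -> {poly R}) (t : R) (dp : {poly R}) : Prop :=
  forall k, is_derive (fun s => (p s)`_k) t dp`_k.

Lemma is_derive_poly_mul (p q : R -> {poly R}) t dp dq :
  is_derive_poly p t dp -> is_derive_poly q t dq ->
  is_derive_poly (fun s => p s * q s) t (dp * q t + p t * dq).
Proof.
move=> Dp Dq k; rewrite coefD !coefM -big_split.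
apply: (is_derive_ext (fun s => \sum_(i < k.+1) (p s)`_i * (q s)`_(k - i))) => [s|].
  by rewrite coefM.
by apply: is_derive_sum => i; apply: is_derive_mulr; [apply: Dp | apply: Dq].
Qed.

Section DifferentiableMoments.
Variables (m : R -> nat -> R) (dm : nat -> R) (t : R).
Hypothesis Dm : forall k, is_derive (fun s => m s k) t (dm k).

Lemma is_derive_riesz n (p : R -> {poly R}) (dp : {poly R}) :
  (forall s, size (p s) <= n)%N -> (size dp <= n)%N -> is_derive_poly p t dp ->
  is_derive (fun s => riesz (m s) (p s)) t (riesz (m t) dp + riesz dm (p t)).
Proof.
move=> le_pn le_dpn Dp; rewrite !(riesz_coef_wide _ (n := n)) // -big_split.
apply: (is_derive_ext (fun s => \sum_(i < n) (p s)`_i * m s i)) => [s|].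
  by rewrite (riesz_coef_wide _ (n := n)).
by apply: is_derive_sum => i; apply: is_derive_mulr.
Qed.

Hypothesis aniso_m : locally t (fun s => anisotropic (m s)).

Let aniso_t : anisotropic (m t) := locally_singleton _ _ aniso_m.

Local Notation P n := (fun s => orthopoly (m s) n).

Lemma ex_derive_coef_orthopoly n (k : 'I_n) : ex_derive (fun s => (P n s)`_k) t.
Proof.
apply: (ex_derive_ext (fun s => - \sum_(j < n) m s (n + j)%N * invmx (hankel (m s) n) j k)).
  by move=> s; rewrite coef_orthopoly.
apply/ex_derive_opp/ex_derive_sum => j; apply: ex_derive_mult; first by eexists; apply: Dm.
apply: ex_derive_invmx => [|i l].
  by apply: filter_imp aniso_m => s aniso_s; apply: hankel_unitmx.
apply: (ex_derive_ext (fun s => m s (i + l)%N)) => [s|]; first by rewrite mxE.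
by eexists; apply: Dm.
Qed.

Definition deriv_orthopoly n : {poly R} := \poly_(k < n) Derive (fun s => (P n s)`_k) t.

Lemma is_derive_orthopoly n : is_derive_poly (P n) t (deriv_orthopoly n).
Proof.
move=> k; rewrite coef_poly; case: ltnP => [lt_kn | le_nk].
  exact/Derive_correct/(ex_derive_coef_orthopoly n (Ordinal lt_kn)).
apply: (is_derive_ext (fun=> (k == n)%:R : R)) => [s|]; last exact: is_derive_const.
case: ltngtP le_nk => // [lt_nk | ->] _; last by rewrite coef_orthopoly_lead.
by rewrite nth_default // (leq_trans (size_orthopoly _ _)).
Qed.

Lemma is_derive_riesz_orthopoly i j :
  is_derive (fun s => riesz (m s) (P i s * P j s)) t
    (riesz (m t) (deriv_orthopoly i * P j t + P i t * deriv_orthopoly j)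
     + riesz dm (P i t * P j t)).
Proof.
have size_mul (p q : {poly R}) : (size p <= i.+1)%N -> (size q <= j.+1)%N ->
    (size (p * q)%R <= i.+1 + j.+1)%N.
  move=> le_pi le_qj; rewrite (leq_trans (size_polyMleq _ _)) //.
  by rewrite (leq_trans (leq_pred _)) // leq_add.
have size_dP n : (size (deriv_orthopoly n) <= n.+1)%N by apply/leqW/size_poly.
apply: (is_derive_riesz (i.+1 + j.+1)).
- by move=> s; rewrite size_mul ?size_orthopoly.
- by rewrite (leq_trans (size_polyD _ _)) // geq_max !size_mul ?size_orthopoly.
- exact: is_derive_poly_mul (is_derive_orthopoly i) (is_derive_orthopoly j).
Qed.

Lemma is_derive_sqnorm n :
  is_derive (fun s => sqnorm (m s) n) t (riesz dm (P n t * P n t)).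
Proof.
have := is_derive_riesz_orthopoly n n; rewrite linearD /= [deriv_orthopoly n * _]mulrC.
by rewrite !riesz_orthopoly_low ?size_poly // !add0r.
Qed.

Lemma is_derive_subleading n :
  is_derive (fun s => subleading (m s) n.+1) t
    (- riesz dm (P n.+1 t * P n t) / sqnorm (m t) n).
Proof.
have D0 : is_derive (fun s => riesz (m s) (P n.+1 s * P n s)) t 0.
  apply: (is_derive_ext_loc (fun=> 0 : R)); last exact: is_derive_const.
  by apply: filter_imp aniso_m => s ?; rewrite riesz_orthopoly_neq // gtn_eqF.
have := is_derive_unique _ _ _ (is_derive_riesz_orthopoly n.+1 n).
rewrite (is_derive_unique _ _ _ D0) linearD /= [deriv_orthopoly n.+1 * _]mulrC.
rewrite riesz_orthopoly ?size_poly // riesz_orthopoly_low ?(leq_trans (size_poly _ _)) //.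
move/eqP; rewrite addr0 eq_sym addr_eq0 => /eqP <-.
by rewrite mulfK ?sqnorm_neq0 //; apply: is_derive_orthopoly.
Qed.

Lemma is_derive_ln_det_hankel n : (forall k, Rlt 0 (sqnorm (m t) k)) ->
  is_derive (fun s => ln (\det (hankel (m s) n))) t
    (\sum_(k < n) riesz dm (P k t * P k t) / sqnorm (m t) k).
Proof.
move=> h_gt0; apply: (is_derive_ext_loc (fun s => ln (\prod_(k < n) sqnorm (m s) k))).
  by apply: filter_imp aniso_m => s aniso_s; rewrite det_hankel.
by apply: is_derive_ln_prod => k; [apply: is_derive_sqnorm | apply: h_gt0].
Qed.

End DifferentiableMoments.
End ParametricMoments.

(** * The stepped Jacobi weight *)

Module SteppedJacobi.
Import all_boot all_order all_algebra ring Rstruct.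
Import Order.TTheory GRing.Theory Num.Theory.
Import MomentFunctionals ParametricMoments.
Local Open Scope ring_scope.

Lemma exists_nonroot_itv {F : numFieldType} (p : {poly F}) (a b : F) :
  p != 0 -> a < b -> exists x, [/\ a < x, x < b & p.[x] != 0].
Proof.
move=> p_neq0 lt_ab; pose rs := [seq a + (b - a) / k.+2%:R | k <- iota 0 (size p)].
have uniq_rs : uniq rs.
  rewrite map_inj_uniq ?iota_uniq // => i j /addrI/mulfI; rewrite subr_eq0 gt_eqF // => /(_ isT).
  by move/invr_inj/eqP; rewrite eqr_nat !eqSS => /eqP.
have /allPn[x /mapP[k _ ->] pk] : ~~ all (root p) rs.
  by apply/negP => /(max_poly_roots p_neq0)/(_ uniq_rs); rewrite size_map size_iota ltnn.
exists (a + (b - a) / k.+2%:R); split=> //.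
  by rewrite ltrDl divr_gt0 ?subr_gt0 ?ltr0Sn.
by rewrite -ltrBrDl ltr_pdivrMr ?ltr0Sn // ltr_pMr ?subr_gt0 // ltr1n.
Qed.

Lemma sumR_big n (f : nat -> R) : sumR n f = \sum_(i < n) f i.
Proof. by elim: n => [|n IH] /=; rewrite ?big_ord0 // big_ord_recr -IH. Qed.

Lemma detn_det n (M : nat -> nat -> R) :
  detn n M = \det (\matrix_(i < n, j < n) M i j).
Proof.
elim: n M => [|n IH] M /=; first by rewrite det_mx00.
rewrite sum_f_R0E big_mkord (expand_det_row _ ord0); apply: eq_bigr => j _.
rewrite /cofactor IH mxE !RealsE add0n mulrCA mulrA.
congr (_ * \det _); apply/matrixP => i k; rewrite !mxE /= /bump; congr (M _ _).
have -> : Nat.ltb k j = (k < j)%N.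
  by apply/idP/idP => [/PeanoNat.Nat.ltb_lt/ssrnat.ltP|/ssrnat.ltP/PeanoNat.Nat.ltb_lt].
by case: ltnP.
Qed.

Lemma polyvalE n (c : nat -> R) x : polyval n c x = (monic_of_coefs n c).[x].
Proof.
rewrite /polyval sumR_big hornerD hornerXn poly_def horner_sum !RealsE; congr (_ + _).
by apply: eq_bigr => k _; rewrite hornerZ hornerXn !RealsE.
Qed.

Section MomentsOfSteppedJacobi.
Variables al be A B : R.
Hypotheses (al_gt0 : Rlt 0 al) (be_gt0 : Rlt 0 be).

Local Notation W := (jacobi al be).
Local Notation mu := (mu al be A B).
Local Notation w := (w al be A B).
Local Notation L t := (riesz (mu t)).

Lemma w_jacobi t x : in01 x -> w t x = W x * (A + B * theta (Rminus x t)).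
Proof. by move=> x_in; rewrite /Defs.w jacobiE ?RealsE. Qed.

Lemma continuous_horner_jacobi (p : {poly R}) x : continuous (fun x => p.[x] * W x) x.
Proof. by apply: continuous_mult; [apply: continuous_horner | apply: continuous_jacobi]. Qed.

Lemma is_RInt_gen_horner_w (p : {poly R}) t : in01 t ->
  is_RInt_gen (fun x => p.[x] * w t x) (at_right 0) (at_left 1)
    (step_RInt (fun x => p.[x] * W x) A B t).
Proof.
move=> t_in.
have intpW := is_RInt_gen_step_RInt _ (continuous_horner_jacobi p) A B t t_in.
apply: is_RInt_gen_ext_itv Rlt_0_1 intpW _ => x x_in.
by rewrite w_jacobi // !RealsE -mulrA.
Qed.

Lemma mu_step_RInt t k : in01 t -> mu t k = step_RInt (fun x => ('X^k).[x] * W x) A B t.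
Proof.
move=> t_in; apply/Integral01_is_RInt_gen.
apply: is_RInt_gen_ext_itv Rlt_0_1 (is_RInt_gen_horner_w 'X^k t t_in) _ => x _.
by rewrite hornerXn !RealsE.
Qed.

Lemma is_RInt_gen_riesz (p : {poly R}) t : in01 t ->
  is_RInt_gen (fun x => p.[x] * w t x) (at_right 0) (at_left 1) (L t p).
Proof.
move=> t_in; have intXn k : is_RInt_gen (fun x => p`_k * (('X^k).[x] * w t x))
    (at_right 0) (at_left 1) (p`_k * mu t k).
  by rewrite mu_step_RInt //; apply: is_RInt_gen_scal; apply: is_RInt_gen_horner_w.
apply: is_RInt_gen_ext_itv Rlt_0_1 (is_RInt_gen_sum (size p) _ _ intXn) _ => x _.
by rewrite horner_coef mulr_suml; apply: eq_bigr => k _; rewrite hornerXn mulrA.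
Qed.

Lemma riesz_step_RInt (p : {poly R}) t : in01 t ->
  L t p = step_RInt (fun x => p.[x] * W x) A B t.
Proof.
move=> t_in.
exact: is_RInt_gen_uniq (is_RInt_gen_riesz p t t_in) (is_RInt_gen_horner_w p t t_in).
Qed.

Lemma Integral01_horner_w (f : R -> R) (p : {poly R}) t : in01 t ->
  (forall x, f x = p.[x] * w t x) -> Integral01 f = L t p.
Proof.
move=> t_in fE; apply: Integral01_is_RInt_gen.
apply: is_RInt_gen_ext_itv Rlt_0_1 (is_RInt_gen_riesz p t t_in) _ => x _.
by rewrite fE.
Qed.

Lemma is_derive_mu t : in01 t ->
  forall k, is_derive (fun s => mu s k) t (- B * W t * t ^+ k).
Proof.
move=> t_in k.
apply: (is_derive_ext_loc (step_RInt (fun x => ('X^k).[x] * W x) A B)).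
  by apply: filter_imp (locally_in01 _ t_in) => s s_in; rewrite mu_step_RInt.
have -> : - B * W t * t ^+ k = Rmult (Ropp B) (('X^k).[t] * W t).
  by rewrite hornerXn !RealsE; ring.
exact: is_derive_step_RInt (continuous_horner_jacobi _) _ _ _.
Qed.

(* [Q W] vanishes at 0 and 1, so that only the jump of the weight at [t] contributes. *)
Lemma is_RInt_gen_derive_horner_jacobi (Q : {poly R}) t : in01 t -> Q.[0] = 0 ->
  is_RInt_gen (fun x => (Q^`().[x] + Q.[x] * (al / x - be / (1 - x))) * w t x)
    (at_right 0) (at_left 1) (- B * (Q.[t] * W t)).
Proof.
move=> t_in Q0; pose K x := Q.[x] * W x.
pose phi x := Q^`().[x] + Q.[x] * (al / x - be / (1 - x)).
have cK x : continuous K x by apply: continuous_horner_jacobi.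
have DK x : in01 x -> is_derive K x (phi x * W x).
  move=> x_in; have DW := is_derive_jacobi al be x x_in.
  have := is_derive_mulr _ _ _ _ _ (is_derive_horner Q x) DW.
  by congr is_derive; rewrite !RealsE /phi [RHS]mulrDl -[in RHS]mulrA.
have cphiW x : in01 x -> continuous (fun x => phi x * W x) x.
  move=> x_in; apply: continuous_mult; last exact: continuous_jacobi.
  apply: continuous_plus; first exact: continuous_horner.
  apply: continuous_mult; first exact: continuous_horner.
  exact: continuous_logderiv_jacobi.
have -> : - B * K t = Rplus (Rmult A (Rminus (K 1) (K 0))) (Rmult B (Rminus (K 1) (K t))).
  by rewrite /K Q0 jacobi_at1 !RealsE; ring.
have intK := is_RInt_gen_step _ _ K _ DK cphiW A B t t_in (cK 0) (cK 1).
apply: is_RInt_gen_ext_itv Rlt_0_1 intK _ => x x_in.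
by rewrite w_jacobi // !RealsE -mulrA.
Qed.

Lemma in01_neq0 x : in01 x -> x != 0 /\ 1 - x != 0.
Proof.
move=> [x_gt0 x_lt1]; split; apply/eqP; first exact: Rgt_not_eq.
exact/Rgt_not_eq/Rlt_0_minus.
Qed.

Lemma riesz_jacobi_op (q : {poly R}) t : in01 t ->
  L t (jacobi_op al be q) = - B * (t * (1 - t) * q.[t] * W t).
Proof.
move=> t_in; pose Q := 'X * (1 - 'X) * q.
have QE x : Q.[x] = x * (1 - x) * q.[x] by rewrite !hornerE.
have Q0 : Q.[0] = 0 by rewrite QE !mul0r.
rewrite -QE; apply: is_RInt_gen_uniq (is_RInt_gen_riesz _ t t_in) _.
apply: is_RInt_gen_ext_itv Rlt_0_1 (is_RInt_gen_derive_horner_jacobi Q t t_in Q0) _.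
move=> x x_in; have [x_neq0 x_neq1] := in01_neq0 x x_in; congr (_ * _).
rewrite QE /Q !(derivM, derivB, derivX, derivC) /jacobi_op !hornerE.
by field; apply/andP.
Qed.

Lemma Integral01_div_onem (q : {poly R}) (f : R -> R) t : in01 t ->
  (forall x, f x = q.[x] / (1 - x) * w t x) ->
  be * Integral01 f = L t ((1 + al + be) *: q + 'X * q^`()) + B * (t * q.[t] * W t).
Proof.
move=> t_in fE; pose Q := 'X * q.
have QE x : Q.[x] = x * q.[x] by rewrite !hornerE.
have dQE x : Q^`().[x] = q.[x] + x * q^`().[x] by rewrite derivM derivX !hornerE.
have Q0 : Q.[0] = 0 by rewrite QE mul0r.
have be_neq0 : be != 0 by apply/eqP/Rgt_not_eq.
pose p := (1 + al + be) *: q + 'X * q^`().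
have pE x : p.[x] = (1 + al + be) * q.[x] + x * q^`().[x] by rewrite !hornerE.
have intp := is_RInt_gen_riesz p t t_in.
have intQ := is_RInt_gen_derive_horner_jacobi Q t t_in Q0.
have -> : Integral01 f = be^-1 * L t p + - be^-1 * (- B * (Q.[t] * W t)).
  apply: Integral01_is_RInt_gen.
  apply: is_RInt_gen_ext_itv Rlt_0_1 (is_RInt_gen_lincomb be^-1 (- be^-1) _ _ _ _ intp intQ) _.
  move=> x x_in; have [x_neq0 x_neq1] := in01_neq0 x x_in; rewrite fE; move: (w t x) => wx.
  by rewrite pE QE dQE !RealsE; field; apply/and3P.
by rewrite -/p QE; field.
Qed.

Hypotheses (A_ge0 : Rle 0 A) (AB_ge0 : Rle 0 (Rplus A B)) (AB_neq0 : ~ (A = 0 /\ B = 0)).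

Lemma riesz_sqr_gt0 (p : {poly R}) t : in01 t -> p != 0 -> Rlt 0 (L t (p * p)).
Proof.
move=> t_in p_neq0; have [t_gt0 t_lt1] := t_in.
rewrite riesz_step_RInt //.
have sqrE x : (p * p).[x] = p.[x] * p.[x] by rewrite hornerM.
have pos_point a b : Rle 0 a -> Rlt a b -> Rle b 1 ->
    exists x, (Rlt a x /\ Rlt x b) /\ Rlt 0 ((p * p).[x] * W x).
  move=> a_ge0 /RltP lt_ab b_le1.
  have [x [/RltP ax /RltP xb px]] := exists_nonroot_itv p a b p_neq0 lt_ab.
  exists x; split=> //; rewrite sqrE; apply: Rmult_lt_0_compat; first exact/Rlt_0_sqr/eqP.
  by apply: jacobi_gt0; split; [exact: Rle_lt_trans ax | exact: Rlt_le_trans xb _].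
apply: step_RInt_gt0 => // [x|z _|||].
- exact: continuous_horner_jacobi.
- by rewrite sqrE; apply: Rmult_le_pos; [exact: Rle_0_sqr | exact: jacobi_ge0].
- by split; exact: Rlt_le.
- by apply: pos_point => //; [exact: Rle_refl | exact: Rlt_le].
- by apply: pos_point => //; [exact: Rlt_le | exact: Rle_refl].
Qed.

Lemma anisotropic_mu t : in01 t -> anisotropic (mu t).
Proof.
move=> t_in p Lpp0; apply/eqP/negPn/negP => /(riesz_sqr_gt0 p t t_in).
by rewrite Lpp0; apply: Rlt_irrefl.
Qed.

Lemma locally_anisotropic_mu t : in01 t -> locally t (fun s => anisotropic (mu s)).
Proof. by move=> /locally_in01; apply: filter_imp => s; apply: anisotropic_mu. Qed.

Lemma sqnorm_mu_gt0 t : in01 t -> forall n, Rlt 0 (sqnorm (mu t) n).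
Proof. by move=> t_in n; apply/riesz_sqr_gt0/monic_deg_neq0/orthopoly_deg. Qed.

Local Notation kappa n t := (jacobi_potential (mu t) al be n).

Lemma orthopoly_sqr_telescope t k : in01 t ->
  - B * W t * (orthopoly (mu t) k * orthopoly (mu t) k).[t] / sqnorm (mu t) k
  = (kappa k.+1 t - kappa k t) / (t * (1 - t)).
Proof.
move=> t_in; have [t_neq0 t_neq1] := in01_neq0 t t_in.
have aniso_t := anisotropic_mu t t_in; have h_neq0 := sqnorm_neq0 aniso_t k.
apply: (mulIf h_neq0); rewrite divfK // [RHS]mulrAC -riesz_jacobi_op_sqr // riesz_jacobi_op //.
by field; apply/andP.
Qed.

Lemma is_derive_ln_Dn n t : in01 t ->
  is_derive (fun s => ln (Dn al be A B n s)) t (kappa n t / (t * (1 - t))).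
Proof.
move=> t_in; apply: (is_derive_ext (fun s => ln (\det (hankel (mu s) n)))) => [s|].
  by rewrite /Dn detn_det.
have := is_derive_ln_det_hankel _ _ _ (is_derive_mu t t_in) (locally_anisotropic_mu t t_in) n
  (sqnorm_mu_gt0 t t_in).
congr is_derive; under eq_bigr => k _ do rewrite riesz_dirac orthopoly_sqr_telescope //.
rewrite -mulr_suml -(big_mkord xpredT (fun k => kappa k.+1 t - kappa k t)) telescope_sumr //.
by rewrite /jacobi_potential mulr0 mul0r addr0 subr0.
Qed.

Lemma Hn_potential n t : in01 t -> Hn al be A B n t = - kappa n t.
Proof.
move=> t_in; have [t_neq0 t_neq1] := in01_neq0 t t_in.
have D := is_derive_ln_Dn n t t_in.
have /is_derive_Reals D' : derivable_pt_lim (fun s => ln (Dn al be A B n s)) t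
    (epsilon (inhabits 0) (fun l => derivable_pt_lim (fun s => ln (Dn al be A B n s)) t l)).
  by apply: epsilon_spec; eexists; apply/is_derive_Reals/D.
rewrite /Hn -(is_derive_unique _ _ _ D') (is_derive_unique _ _ _ D) !RealsE.
by field; apply/andP.
Qed.

Local Notation OPc := (OPc al be A B).

Lemma Integral01_polyval n k (c d : nat -> R) t : in01 t ->
  Integral01 (fun x => Rmult (Rmult (polyval n c x) (polyval k d x)) (w t x)) =
  L t (monic_of_coefs n c * monic_of_coefs k d).
Proof.
by move=> t_in; apply: Integral01_horner_w => // x; rewrite !polyvalE hornerM !RealsE.
Qed.

Lemma is_OPS_orthopoly t : in01 t -> is_OPS al be A B t (fun n k => (orthopoly (mu t) n)`_k).
Proof.
move=> t_in; have aniso_t := anisotropic_mu t t_in.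
have PK n : monic_of_coefs n (fun k => (orthopoly (mu t) n)`_k) = orthopoly (mu t) n.
  by apply: monic_of_coefsK; exact: orthopoly_deg.
split=> [i j /eqP ne_ij | i]; rewrite Integral01_polyval // !PK.
  exact: riesz_orthopoly_neq.
exact: sqnorm_mu_gt0.
Qed.

Lemma monic_of_OPc n t : in01 t -> monic_of_coefs n (OPc t n) = orthopoly (mu t) n.
Proof.
move=> t_in; have [OPc_orth _] : is_OPS al be A B t (OPc t).
  by apply: epsilon_spec; eexists; apply: is_OPS_orthopoly.
apply: (orthogonal_monicsE (anisotropic_mu t t_in) (p := fun n => monic_of_coefs n (OPc t n))).
- by move=> i; apply: monic_of_coefs_deg.
- by move=> i j /eqP ne_ij; rewrite -Integral01_polyval // OPc_orth.
Qed.

Lemma P_orthopoly n t x : in01 t -> P al be A B n t x = (orthopoly (mu t) n).[x].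
Proof. by move=> t_in; rewrite /P polyvalE monic_of_OPc. Qed.

Lemma h_sqnorm n t : in01 t -> h al be A B n t = sqnorm (mu t) n.
Proof. by move=> t_in; rewrite /h Integral01_polyval // !monic_of_OPc. Qed.

Lemma p1_subleading n t : in01 t -> p1 al be A B n.+1 t = subleading (mu t) n.+1.
Proof. by move=> t_in; rewrite /p1 -(coef_monic_of_coefs _ (ltnSn n)) monic_of_OPc. Qed.

Lemma r_orthopoly n t : in01 t -> r al be A B n.+1 t =
  B * W t * (orthopoly (mu t) n.+1).[t] * (orthopoly (mu t) n).[t] / sqnorm (mu t) n.
Proof.
move=> t_in; rewrite /r PeanoNat.Nat.sub_1_r /= !P_orthopoly // h_sqnorm // jacobiE //.
by rewrite !RealsE !mulrA.
Qed.

Lemma is_derive_p1 n t : in01 t -> is_derive (p1 al be A B n.+1) t (r al be A B n.+1 t).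
Proof.
move=> t_in; apply: (is_derive_ext_loc (fun s => subleading (mu s) n.+1)).
  by apply: filter_imp (locally_in01 _ t_in) => s s_in; rewrite p1_subleading.
have := is_derive_subleading _ _ _ (is_derive_mu t t_in) (locally_anisotropic_mu t t_in) n.
by congr is_derive; rewrite r_orthopoly // riesz_dirac hornerM; congr (_ / _); ring.
Qed.

Lemma y_sub_tr n t : in01 t ->
  y al be A B n.+1 t - t * r al be A B n.+1 t = - p1 al be A B n.+1 t.
Proof.
move=> t_in; have aniso_t := anisotropic_mu t t_in.
pose Q := orthopoly (mu t) n.+1 * orthopoly (mu t) n.
have h_neq0 : sqnorm (mu t) n != 0 by apply: sqnorm_neq0.
rewrite /y PeanoNat.Nat.sub_1_r /= h_sqnorm // RdivE RmultE mulrAC.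
rewrite (Integral01_div_onem Q _ t) // => [|x]; last first.
  by rewrite !P_orthopoly // hornerM !RealsE.
rewrite riesz_X_deriv_succ // hornerM r_orthopoly // p1_subleading //.
by field.
Qed.

Lemma Hn_p1 n t : in01 t ->
  Hn al be A B n.+1 t = - (2 * INR n.+1 + al + be) * p1 al be A B n.+1 t
    - INR n.+1 * (INR n.+1 + al).
Proof. by move=> t_in; rewrite Hn_potential // p1_subleading // /jacobi_potential INRE; ring. Qed.

Lemma is_derive_Hn n t : in01 t ->
  is_derive (Hn al be A B n.+1) t (- (2 * INR n.+1 + al + be) * r al be A B n.+1 t).
Proof.
move=> t_in; set c := - (2 * _ + _ + _).
apply: (is_derive_ext_loc (fun s => c * p1 al be A B n.+1 s - INR n.+1 * (INR n.+1 + al))).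
  by apply: filter_imp (locally_in01 _ t_in) => s s_in; rewrite Hn_p1.
rewrite -[c * r _ _ _ _ _ _]subr0.
apply: is_derive_minus; last exact: is_derive_const.
exact/is_derive_scal/is_derive_p1.
Qed.

End MomentsOfSteppedJacobi.
End SteppedJacobi.

Theorem theorem3p4 (al be A B : R) (Hal : 0 < al) (Hbe : 0 < be)
  (HA : 0 <= A) (HAB : 0 <= A + B) (Hnz : ~ (A = 0 /\ B = 0))
  (n : nat) (Hn1 : (1 <= n)%nat) (t : R) (Ht : 0 < t < 1) :
  (exists l, derivable_pt_lim (fun s => ln (Dn al be A B n s)) t l) /\
  Hn al be A B n t
    = (2 * INR n + al + be) * (y al be A B n t - t * r al be A B n t)
      - INR n * (INR n + al) /\
  Hn al be A B n t
    = - (2 * INR n + al + be) * p1 al be A B n t - INR n * (INR n + al) /\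
  (exists H', derivable_pt_lim (Hn al be A B n) t H' /\
     r al be A B n t = - H' / (2 * INR n + al + be) /\
     y al be A B n t
       = (- t * H' + Hn al be A B n t + INR n * (INR n + al)) / (2 * INR n + al + be)).
Proof.
case: n Hn1 => [/Nat.nle_succ_0 // | n _].
have y_tr : y al be A B (S n) t - t * r al be A B (S n) t = - p1 al be A B (S n) t.
  exact: SteppedJacobi.y_sub_tr.
have HnE : Hn al be A B (S n) t
    = - (2 * INR (S n) + al + be) * p1 al be A B (S n) t - INR (S n) * (INR (S n) + al).
  exact: SteppedJacobi.Hn_p1.
have c_gt0 : 0 < 2 * INR (S n) + al + be by have := pos_INR (S n); lra.
split; first by eexists; apply/is_derive_Reals/SteppedJacobi.is_derive_ln_Dn.
split; first by rewrite y_tr HnE; ring.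
split; first exact: HnE.
exists (- (2 * INR (S n) + al + be) * r al be A B (S n) t); split.
  exact/is_derive_Reals/SteppedJacobi.is_derive_Hn.
split; first by field; lra.
have -> : y al be A B (S n) t = t * r al be A B (S n) t - p1 al be A B (S n) t by lra.
by rewrite HnE; field; lra.
Qed.
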